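(* Let $K$ be a totally real number field with ring of integers $\mathcal{O}_K$, and let $Q$ be a totally positive definite quadratic form in $n$ variables over $\mathcal{O}_K$. Let $C\in\mathbb{R}$, $C>0$, be such that for every $\beta\in K^{+}$ with $\mathrm{N}_{K/\mathbb{Q}}(\beta)\geq C$ there exists $\alpha\in\mathcal{O}_K^{+}$ such that $\beta\succeq\alpha$. If $\mathrm{N}_{K/\mathbb{Q}}(\det(Q))\geq\gamma_{K,n}^n C^n$, then $Q$ is additively decomposable as $Q=H+\alpha L^2$, where $\alpha\in\mathcal{O}_K^+$, $L$ is a nonzero linear form in $n$ variables with coefficients in $\mathcal{O}_K$, and $H$ is a totally positive semi-definite quadratic form in $n$ variables with coefficients in $\mathcal{O}_K$.
   Context: For $\alpha,\beta\in K$, $\alpha\succ\beta$ (resp. $\alpha\succeq\beta$) means $\sigma(\alpha)>\sigma(\beta)$ (resp. $\sigma(\alpha)\geq\sigma(\beta)$) for every embedding $\sigma:K\to\mathbb{R}$; $\alpha$ is totally positive if $\alpha\succ0$. $K^+$ and $\mathcal{O}_K^+$ denote the sets of totally positive elements of $K$ and $\mathcal{O}_K$. A quadratic form over $\mathcal{O}_K$ in $n$ variables is $Q(\mathbf{x})=\sum_{i\le j}a_{ij}x_ix_j$ with $a_{ij}\in\mathcal{O}_K$. It is totally positive semi-definite if $Q(v)\succeq0$ for all $v\in K^n$, and totally positive definite if moreover $Q(v)=0$ implies $v=0$. Its Gram matrix $M_Q$ is the symmetric matrix with $Q(\mathbf{x})=\mathbf{x}M_Q\mathbf{x}^t$ (so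 off-diagonal entries lie in $\frac12\mathcal{O}_K$), and $\det(Q)=\det(M_Q)$. For a totally positive definite $Q$ of rank $n$ (i.e. in $n$ variables), $\min(Q)=\min\{\mathrm{N}_{K/\mathbb{Q}}(Q(x))\mid x\in\mathcal{O}_K^n\setminus\{0\}\}$. The generalised Hermite constant is $$\gamma_{K,n}=\max_Q\frac{\min(Q)}{\mathrm{N}_{K/\mathbb{Q}}(\det(Q))^{1/n}},$$ the maximum running over all totally positive definite quadratic forms $Q$ of rank $n$ over $\mathcal{O}_K$. *)

(* Defs.v *)
From HB Require Import structures.
From mathcomp Require Export all_boot all_order all_algebra all_field.
From mathcomp Require Export all_classical all_reals all_analysis.
From mathcomp Require Export complex.
Set Implicit Arguments.
Unset Strict Implicit.
Unset Printing Implicit Defensive.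
Import Order.TTheory GRing.Theory Num.Theory.
Local Open Scope classical_set_scope.
Local Open Scope ring_scope.

(* A number field is a finite extension K of rat: a fieldExtType rat. *)

(* Every complex embedding of K has its image in the real line. *)
Definition totally_real (R : realType) (K : fieldExtType rat) : Prop :=
  forall (s : {rmorphism K -> complex R}) (x : K), complex.Im (s x) = 0.

(* Membership in the ring of integers of K. *)
Definition in_OK (K : fieldExtType rat) (x : K) : Prop :=
  integralOver (intr : int -> K) x.

Definition tot_gt (R : realType) (K : fieldExtType rat) (x y : K) : Prop :=
  forall s : {rmorphism K -> R}, s y < s x.

Definition tot_ge (R : realType) (K : fieldExtType rat) (x y : K) : Prop :=
  forall s : {rmorphism K -> R}, s y <= s x.

Definition tot_pos (R : realType) (K : fieldExtType rat) (x : K) : Prop :=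
  tot_gt R x 0.

(* N_{K/Q}(x): determinant of the Q-linear map y |-> x * y. *)
Definition normKQ (K : fieldExtType rat) (x : K) : rat :=
  \det (passmx.mxof (vbasis {:K}) (vbasis {:K}) (amull x)).

(* A quadratic form sum_(i <= j) a_ij x_i x_j is given by its upper triangular
   matrix a of coefficients; this is not the Gram matrix. *)
Definition qf_over_OK (K : fieldExtType rat) (n : nat) (a : 'M[K]_n) : Prop :=
  (forall i j : 'I_n, in_OK (a i j)) /\
  (forall i j : 'I_n, (j < i)%N -> a i j = 0).

Definition qf_eval (K : fieldExtType rat) (n : nat) (a : 'M[K]_n)
    (x : 'rV[K]_n) : K :=
  \sum_(i < n) \sum_(j < n | (i <= j)%N) a i j * x 0 i * x 0 j.

Definition gram (K : fieldExtType rat) (n : nat) (a : 'M[K]_n) : 'M[K]_n :=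
  \matrix_(i, j) (if i == j then a i i
                  else if (i < j)%N then a i j / 2%:R else a j i / 2%:R).

Definition qf_det (K : fieldExtType rat) (n : nat) (a : 'M[K]_n) : K :=
  \det (gram a).

Definition tot_pos_semidef (R : realType) (K : fieldExtType rat) (n : nat)
    (a : 'M[K]_n) : Prop :=
  forall v : 'rV[K]_n, tot_ge R (qf_eval a v) 0.

Definition tot_pos_def (R : realType) (K : fieldExtType rat) (n : nat)
    (a : 'M[K]_n) : Prop :=
  tot_pos_semidef R a /\ forall v : 'rV[K]_n, qf_eval a v = 0 -> v = 0.

(* For a totally positive definite form over O_K with n > 0 the norms are
   positive integers, so this infimum is a minimum. *)
Definition qf_min (R : realType) (K : fieldExtType rat) (n : nat)
    (a : 'M[K]_n) : R :=
  inf [set m : R | exists x : 'rV[K]_n,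
    [/\ forall i, in_OK (x 0 i), x != 0 & m = ratr (normKQ (qf_eval a x))]].

(* The constant is a least upper bound, taken in \bar R where it always exists;
   it equals the maximum of the quotients whenever some form over O_K attains
   it. That it is finite is a classical theorem. *)
Definition hermite (R : realType) (K : fieldExtType rat) (n : nat) : \bar R :=
  ereal_sup [set g : \bar R | exists a : 'M[K]_n,
    [/\ qf_over_OK a, tot_pos_def R a &
        g = (qf_min R a /
             (ratr (normKQ (qf_det a)) `^ (n%:R^-1)))%:E]].

Definition lf_eval (K : fieldExtType rat) (n : nat) (l x : 'rV[K]_n) : K :=
  \sum_(i < n) l 0 i * x 0 i.

(* Main.v *)
From HB Require Import structures.
From mathcomp Require Import ring.
Require Import Defs.
Import Order.TTheory GRing.Theory Num.Theory.
Local Open Scope ring_scope.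
Set Implicit Arguments.
Unset Strict Implicit.
Unset Printing Implicit Defensive.

(** Let M be the Gram matrix of Q.  For a linear form L != 0 put
    w = L M^-1, so that B(w, x) = L(x) for the bilinear form B of Q, and
    q = Q(w) = L M^-1 L^t, which is totally positive.  Cauchy-Schwarz gives
    L(x)^2 <= Q(x) q under every real embedding, so Q - a L^2 is totally
    positive semi-definite as soon as a is at most 1/q at every embedding
    ([qf_sub_sq_psd]).  By the hypothesis on C such a totally positive integer
    a exists once N(1/q) >= C, so it is enough to find an integral L for which
    N(L M^-1 L^t) is at most 1/C.

    This is a short vector problem for the dual form.  Choose a positive
    integer m such that m M^-1 is the Gram matrix of a form over O_K
    ([dual_OK]).  A minimal vector L of that form satisfies
      N(m) N(q) <= gamma N(det (m M^-1))^(1/n) = gamma N(m) / N(det Q)^(1/n),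
    and N(det Q)^(1/n) >= gamma C turns this into N(q) <= 1/C
    ([dual_short_vector]).  Cauchy-Schwarz and the duality are carried out with
    vectors over K; no form is ever extended to the reals.  The assumed bound
    on N(det Q) also forces gamma to be finite ([hermite_fin]).

    Two facts about the norm support this.  It is positive on totally positive
    elements, which makes gamma > 0 and lets inequalities be inverted, and it
    is an integer on algebraic integers, so that the minimum of a form is
    attained.  Both follow from [normKQ_prod_embeddings]: over an algebraically
    closed field, the norm of x is a product of values s x at embeddings s of
    K, because each eigenvalue of multiplication by x is such a value. *)

(** * The norm as a product of values at embeddings *)

Lemma rmorphism_of_fun (A B : nzRingType) (f : A -> B) :
  zmod_morphism f -> monoid_morphism f ->
  exists g : {rmorphism A -> B}, g =1 f.
Proof.
move=> fB fM.
pose g : {rmorphism A -> B} :=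
  HB.pack f (GRing.isZmodMorphism.Build _ _ f fB)
    (GRing.isMonoidMorphism.Build _ _ f fM).
by exists g.
Qed.

Section Norm.
Variable K : fieldExtType rat.
Implicit Types x y : K.

Definition mulmat x := passmx.mxof (vbasis {:K}) (vbasis {:K}) (amull x).

Let eK : basis_of {:K} (vbasis {:K}) := vbasisP {:K}.

Lemma mulmatE x (i j : 'I_(\dim {:K})) :
  mulmat x i j = coord (vbasis {:K}) j (x * (vbasis {:K})`_i).
Proof. by rewrite !mxE /= passmx.vecof_delta lfunE. Qed.

Lemma mulmat_linear : linear mulmat.
Proof.
move=> c x y; apply/matrixP => i j.
by rewrite !(mulmatE, mxE) mulrDl -scalerAl linearP.
Qed.

HB.instance Definition _ := GRing.isSemilinear.Build rat K _ _ mulmat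
  (GRing.semilinear_linear mulmat_linear).

Lemma mulmat1 : mulmat 1 = 1%:M.
Proof.
by rewrite /mulmat amull1 passmx.mxof1 // (basis_free eK).
Qed.

Lemma mulmatM x y : mulmat (x * y) = mulmat x *m mulmat y.
Proof. by rewrite mulrC /mulmat amullM -passmx.mxof_comp. Qed.

Lemma normKQM x y : normKQ (x * y) = normKQ x * normKQ y.
Proof. by rewrite /normKQ -!/(mulmat _) mulmatM det_mulmx. Qed.

Lemma normKQ1 : normKQ (1 : K) = 1.
Proof. by rewrite /normKQ -!/(mulmat _) mulmat1 det1. Qed.

Lemma normKQX x n : normKQ (x ^+ n) = normKQ x ^+ n.
Proof. by elim: n => [|n IH]; rewrite ?normKQ1 // !exprS normKQM IH. Qed.

Lemma normKQ_neq0 x : x != 0 -> normKQ x != 0.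
Proof.
move=> x0; have : normKQ x * normKQ x^-1 = 1 by rewrite -normKQM divff // normKQ1.
by apply: contra_eq_neq => ->; rewrite mul0r eq_sym oner_neq0.
Qed.

Lemma normKQV x : x != 0 -> normKQ x^-1 = (normKQ x)^-1.
Proof.
move=> x0; apply: (mulIf (normKQ_neq0 x0)).
by rewrite -normKQM !mulVf ?normKQ1 ?normKQ_neq0.
Qed.

(** The basis of K, as a column vector, is an eigenvector of the matrix of x
    with eigenvalue x itself; this makes x a root of the characteristic
    polynomial of a rational matrix. *)
Lemma mulmat_basis x (i : 'I_(\dim {:K})) :
  x * (vbasis {:K})`_i = \sum_j mulmat x i j *: (vbasis {:K})`_j.
Proof.
rewrite [LHS](coord_basis eK (memvf _)); apply: eq_bigr => j _; congr (_ *: _).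
by rewrite mulmatE.
Qed.

Section Embeddings.
Variable C : numClosedFieldType.

Let A x : 'M[C]_(\dim {:K}) := map_mx ratr (mulmat x).

Let A1 : A 1 = 1%:M.
Proof. by rewrite /A mulmat1 map_scalar_mx rmorph1. Qed.
Let AM x y : A (x * y) = A x *m A y.
Proof. by rewrite /A mulmatM map_mxM. Qed.
Let AB x y : A (x - y) = A x - A y.
Proof. by rewrite /A linearB map_mxB. Qed.

(** The matrices A y commute, so they act on the l-eigenspace of A x, where
    they have a common eigenvector v.  The eigenvalue of A y at v is a ring
    morphism in y, and it sends x to l. *)
Lemma embedding_of_eigenvalue x (l : C) :
  eigenvalue (A x) l -> exists s : {rmorphism K -> C}, s x = l.
Proof.
move=> xl; pose W := row_base (eigenspace (A x) l).
have stW y : stablemx W (A y).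
  rewrite stablemx_row_base; apply: comm_mx_stable_eigenspace.
  by rewrite /comm_mx -!AM mulrC.
have W0 : (0 < \rank (eigenspace (A x) l))%N by rewrite lt0n mxrank_eq0.
(* Finitely many matrices suffice: those of a basis, restricted to W. *)
pose As := [seq conjmx W (A y) | y <- vbasis {:K}].
have cW y z : conjmx W (A y) *m conjmx W (A z) = conjmx W (A (y * z)).
  by rewrite AM conjmxM ?row_base_free // inE.
have [|u u0 /allP /= stu] := @common_eigenvector C _ As W0.
  move=> _ _ /mapP[y _ ->] /mapP[z _ ->].
  by rewrite /comm_mx !cW mulrC.
pose v := u *m W.
have v0 : v != 0 by rewrite mulmx_free_eq0 ?row_base_free.
have vx : v *m A x = l *: v.
  apply/eigenspaceP; rewrite /v (submx_trans (submxMl _ _)) //.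
  by rewrite eq_row_base.
have stv y : exists a, v *m A y = a *: v.
  apply/sub_rVP; rewrite /A (coord_vbasis (memvf y)) linear_sum map_mx_sum.
  rewrite mulmx_sumr summx_sub // => i _.
  rewrite linearZ /= map_mxZ -scalemxAr scalemx_sub //.
  have /stu : conjmx W (A (vbasis {:K})`_i) \in As.
    by apply/mapP; exists (vbasis {:K})`_i; rewrite ?mem_nth ?size_tuple.
  by rewrite stablemx_restrict // -stablemx_row_base.
have [i vi] : exists i, v 0 i != 0.
  by apply/rV0Pn; exact: v0.
(* A nonzero coordinate of v gives the eigenvalue as an explicit function. *)
pose f y := (v *m A y) 0 i / v 0 i.
have fP y : v *m A y = f y *: v.
  by have [a e] := stv y; rewrite /f e mxE mulfK.
have inj a b : a *: v = b *: v -> a = b.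
  by move=> /rowP/(_ i); rewrite ![(_ *: v) _ _]mxE => /(mulIf vi).
have [||s sf] := @rmorphism_of_fun K C f.
- by move=> y z; apply: inj; rewrite scalerBl -!fP AB mulmxBr.
- split=> [|y z]; apply: inj; rewrite -?fP; first by rewrite A1 mulmx1 scale1r.
  by rewrite AM mulmxA fP -scalemxAl fP scalerA.
- by exists s; apply: inj; rewrite sf -fP.
Qed.

(** The determinant of multiplication by x is the product of the roots of its
    characteristic polynomial, and these are eigenvalues. *)
Lemma normKQ_prod_embeddings x : exists2 r : seq C,
  ratr (normKQ x) = \prod_(l <- r) l &
  forall l, l \in r -> exists s : {rmorphism K -> C}, s x = l.
Proof.
have [r Dr] := closed_field_poly_normal (char_poly (A x)).
move: Dr; rewrite (monicP (char_poly_monic _)) scale1r => Dr.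
exists r; last first.
  move=> l lr; apply: embedding_of_eigenvalue.
  by rewrite eigenvalue_root_char Dr root_prod_XsubC.
rewrite /normKQ -/(mulmat _) -det_map_mx -/(A x).
have sr : size r = \dim {:K}.
  by have := size_char_poly (A x); rewrite Dr size_prod_XsubC => -[].
apply: (can_inj (signrMK (\dim {:K}))).
rewrite -char_poly_det Dr -horner_coef0 horner_prod -sr.
elim: (r) => [|l r' IH]; first by rewrite !big_nil mulr1.
by rewrite !big_cons IH hornerXsubC sub0r /= exprS mulN1r !mulNr mulrCA.
Qed.

End Embeddings.
End Norm.

(** * Norms of totally positive elements and of integers *)

Lemma real_embedding (R : realType) (K : fieldExtType rat) :
  totally_real R K -> forall s : {rmorphism K -> complex R},
  exists t : {rmorphism K -> R}, forall x, s x = (t x)%:C%C.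
Proof.
move=> K_real s.
have sE x : s x = (complex.Re (s x))%:C%C.
  by rewrite [LHS]complexE K_real mulr0 addr0.
have [||t tE] := @rmorphism_of_fun K R (fun x => complex.Re (s x)).
- by move=> x y; rewrite rmorphB raddfB.
- split=> [|x y]; first by rewrite rmorph1.
  by rewrite rmorphM sE [s y]sE -rmorphM.
- by exists t => x; rewrite tE -sE.
Qed.

(** Every embedding occurring in the product formula over the complex numbers
    is real, so each factor is positive. *)
Lemma normKQ_gt0 (R : realType) (K : fieldExtType rat) (x : K) :
  totally_real R K -> tot_pos R x -> 0 < normKQ x.
Proof.
move=> K_real x_gt0.
have [r Dr sr] := normKQ_prod_embeddings (complex R) x.
rewrite -(ltr0q (complex R)) Dr big_seq prodr_gt0 // => l /sr[s <-].
have [t ->] := real_embedding K_real s.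
by rewrite ltcR -(rmorph0 t) x_gt0.
Qed.

(** Each factor of the product formula over algC is an algebraic integer, and
    a rational algebraic integer is an integer. *)
Lemma normKQ_int (K : fieldExtType rat) (x : K) :
  in_OK x -> normKQ x \is a Num.int.
Proof.
move=> [p p_monic px0].
have [r Dr sr] := normKQ_prod_embeddings algC x.
have: ratr (normKQ x) \in Aint.
  rewrite Dr big_seq rpred_prod // => l /sr[s <-].
  apply: (@root_monic_Aint (map_poly intr p)).
  - move: (rmorph_root s px0); rewrite -map_poly_comp.
    by congr (is_true (root _ _)); apply: eq_map_poly => z /=; rewrite rmorph_int.
  - exact: monic_map.
  - by apply/polyOverP => i; rewrite coef_map /= intr_int.
move/(Cint_rat_Aint (Crat_rat _)).
by case/intrP=> z; rewrite -(ratr_int algC) => /fmorph_inj ->; exact: intr_int.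
Qed.

(** * Clearing denominators *)

Lemma uniform_multiple (T : nmodType) (S : T -> Prop) (I : finType) (y : I -> T) :
  (forall x k, S x -> S (x *+ k)) ->
  (forall i, exists m, (0 < m)%N /\ S (y i *+ m)) ->
  exists m, (0 < m)%N /\ forall i, S (y i *+ m).
Proof.
move=> Sn /choice[m mP]; exists (\prod_i m i)%N; split=> [|i].
  by apply: prodn_gt0 => i; case: (mP i).
by rewrite (bigD1 i) //= mulrnA; apply: Sn; case: (mP i).
Qed.

Lemma rat_integral_multiple (q : rat) :
  exists m, (0 < m)%N /\ q *+ m \is a Num.int.
Proof.
exists `|denq q|%N; rewrite absz_gt0 denq_neq0; split=> //.
by rewrite pmulrn abszE normr_denq -mulrzr -numqE intr_int.
Qed.

Lemma in_OK0 (K : fieldExtType rat) : in_OK (0 : K).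
Proof. exact: mxpoly.integral0. Qed.

Lemma in_OK1 (K : fieldExtType rat) : in_OK (1 : K).
Proof. exact: mxpoly.integral1. Qed.

Lemma in_OK_add (K : fieldExtType rat) (x y : K) :
  in_OK x -> in_OK y -> in_OK (x + y).
Proof. exact: mxpoly.integral_add. Qed.

Lemma in_OK_sub (K : fieldExtType rat) (x y : K) :
  in_OK x -> in_OK y -> in_OK (x - y).
Proof. exact: mxpoly.integral_sub. Qed.

Lemma in_OK_mul (K : fieldExtType rat) (x y : K) :
  in_OK x -> in_OK y -> in_OK (x * y).
Proof. exact: mxpoly.integral_mul. Qed.

Lemma in_OK_mulrn (K : fieldExtType rat) (x : K) k : in_OK x -> in_OK (x *+ k).
Proof.
move=> x_OK; elim: k => [|k IH]; first exact: in_OK0.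
by rewrite mulrS; apply: in_OK_add.
Qed.

(** If m clears the denominators of the matrix of x, then x *+ m is an
    eigenvalue of an integer matrix, hence a root of a monic integer
    polynomial. *)
Lemma integral_multiple (K : fieldExtType rat) (x : K) :
  exists m, (0 < m)%N /\ in_OK (x *+ m).
Proof.
pose d := \dim {:K}.
have [m [m_gt0 mP]] := @uniform_multiple rat (fun q => q \is a Num.int)
  ('I_d * 'I_d)%type (fun ij => mulmat x ij.1 ij.2)
  (fun q k qz => rpredMn k qz) (fun ij => rat_integral_multiple _).
exists m; split=> //.
(* B is transposed since eigenvectors act on the left of matrices. *)
have [B BE] : exists B : 'M[int]_d, forall i j, (B i j)%:~R = mulmat x j i *+ m.
  exists (\matrix_(i, j) Num.floor (mulmat x j i *+ m)) => i j.
  by rewrite mxE floorK // (mP (j, i)).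
exists (char_poly B); first exact: char_poly_monic.
rewrite map_char_poly -eigenvalue_root_char.
apply/eigenvalueP; exists (\row_j (vbasis {:K})`_j).
  apply/rowP => i; rewrite !mxE mulrnAl mulmat_basis -sumrMnl.
  apply: eq_bigr => j _; rewrite [X in X * _]mxE [X in _ * X]mxE /=.
  have <- : (B j i)%:~R%:A = (B j i)%:~R :> K by rewrite -in_algE rmorph_int.
  by rewrite BE mulr_algr scalerMnl.
apply/eqP => /rowP b0; suff: (1 : K) == 0 by rewrite oner_eq0.
rewrite (coord_vbasis (memvf 1)) big1 // => j _.
by have := b0 j; rewrite !mxE => ->; rewrite scaler0.
Qed.

(** * Quadratic forms and their Gram matrices *)

Section Gram.
Variables (K : fieldExtType rat) (n : nat).
Implicit Types (a G : 'M[K]_n) (x y v w : 'rV[K]_n).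

Lemma natK_neq0 k : (0 < k)%N -> k%:R != 0 :> K.
Proof.
move=> k_gt0; rewrite -scaler_nat scaler_eq0 oner_eq0 orbF.
by rewrite pnatr_eq0 -lt0n.
Qed.

Definition bilin G x y : K := (x *m G *m y^T) 0 0.

Lemma bilinDl G x y z : bilin G (x + y) z = bilin G x z + bilin G y z.
Proof. by rewrite /bilin !mulmxDl mxE. Qed.

Lemma bilinZl G c x y : bilin G (c *: x) y = c * bilin G x y.
Proof. by rewrite /bilin -!scalemxAl mxE. Qed.

Lemma bilin_sum G x y : bilin G x y = \sum_i \sum_j x 0 i * G i j * y 0 j.
Proof.
rewrite /bilin mxE exchange_big /=; apply: eq_bigr => j _.
by rewrite !mxE mulr_suml.
Qed.

Lemma bilinC G x y : G^T = G -> bilin G x y = bilin G y x.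
Proof.
move=> G_sym; rewrite !bilin_sum exchange_big /=.
apply: eq_bigr => i _; apply: eq_bigr => j _.
by rewrite -{1}G_sym mxE; ring.
Qed.

Lemma gram_sym a : (gram a)^T = gram a.
Proof.
apply/matrixP => i j; rewrite !mxE -val_eqE -[i == j]val_eqE /= eq_sym.
by case: ltngtP => // /val_inj ->.
Qed.

Lemma qf_evalE a x : qf_eval a x = bilin (gram a) x x.
Proof.
(* Twice both sides: the Gram matrix symmetrizes the triangular sum. *)
pose t (i j : 'I_n) := if (i <= j)%N then a i j * x 0 i * x 0 j else 0.
have -> : qf_eval a x = \sum_i \sum_j t i j.
  by apply: eq_bigr => i _; rewrite big_mkcond.
have n2 : 2%:R != 0 :> K by exact: natK_neq0.
apply: (mulfI n2); rewrite mulr_natl mulr2n {2}exchange_big /= -big_split /=.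
rewrite bilin_sum mulr_sumr; apply: eq_bigr => i _.
rewrite -big_split mulr_sumr; apply: eq_bigr => j _ /=.
rewrite /t mxE -val_eqE /=; case: ltngtP => [ij|ij|/val_inj <-]; first by field.
- by field.
- ring.
Qed.

Definition qf_of_gram G : 'M[K]_n :=
  \matrix_(i, j) if i == j then G i i
                 else if (i < j)%N then G i j *+ 2 else 0.

Lemma gramK G : G^T = G -> gram (qf_of_gram G) = G.
Proof.
move=> G_sym; have Gij i j : G j i = G i j by rewrite -{1}G_sym mxE.
have n2 : 2%:R != 0 :> K by exact: natK_neq0.
apply/matrixP => i j; rewrite !mxE eqxx -val_eqE /=.
rewrite -[j == i]val_eqE /=.
by case: ltngtP => [ij|ij|/val_inj -> //]; rewrite -[X in X / _]mulr_natr mulfK.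
Qed.

Lemma qf_of_gram_OK G :
  (forall i, in_OK (G i i)) -> (forall i j, in_OK (G i j *+ 2)) ->
  qf_over_OK (qf_of_gram G).
Proof.
move=> Gd_OK G_OK; split=> i j; rewrite mxE; last first.
  by move=> ji; rewrite -val_eqE /= gtn_eqF // ltnNge ltnW.
by case: eqP => // _; case: ifP => _ //; exact: in_OK0.
Qed.

Lemma gram_OK a : qf_over_OK a ->
  (forall i, in_OK (gram a i i)) /\ (forall i j, in_OK (gram a i j *+ 2)).
Proof.
move=> [a_OK _]; have n2 : 2%:R != 0 :> K by exact: natK_neq0.
split=> [i|i j]; rewrite mxE ?eqxx //.
case: eqP => _; first exact: in_OK_mulrn.
by case: ifP => _; rewrite -[X in in_OK X]mulr_natr divfK.
Qed.

(** The identity behind the Cauchy-Schwarz inequality: q v - b w is q times the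
    component of v orthogonal to w. *)
Lemma bilin_quad_sub G q b v w : G^T = G -> bilin G w w = q -> bilin G v w = b ->
  bilin G (q *: v - b *: w) (q *: v - b *: w) = q * (q * bilin G v v - b ^+ 2).
Proof.
move=> G_sym qE bE.
have bilin_l x : bilin G (q *: v - b *: w) x = q * bilin G v x - b * bilin G w x.
  by rewrite bilinDl bilinZl -scaleNr bilinZl mulNr.
by rewrite bilin_l !(bilinC _ (_ - _) G_sym) !bilin_l (bilinC w v) // qE bE; ring.
Qed.

End Gram.

Section Definite.
Variables (R : realType) (K : fieldExtType rat) (n : nat) (Q : 'M[K]_n).
Hypothesis Q_pos : tot_pos_def R Q.

Lemma tot_pos_def_neq0 v : v != 0 -> qf_eval Q v != 0.
Proof. by apply: contra_neq; case: Q_pos => _; apply. Qed.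

Lemma tot_pos_def_gt0 v : v != 0 -> tot_pos R (qf_eval Q v).
Proof.
move=> v0 s; rewrite lt_def (proj1 Q_pos) rmorph0 fmorph_eq0 andbT.
exact: tot_pos_def_neq0.
Qed.

(** A vector in the kernel of the Gram matrix is isotropic. *)
Lemma gram_unit : gram Q \in unitmx.
Proof.
rewrite -row_free_unit -kermx_eq0; apply/rowV0P => v /sub_kermxP vG.
by apply: (proj2 Q_pos); rewrite qf_evalE /bilin vG mul0mx mxE.
Qed.

Lemma cauchy_schwarz v w :
  tot_ge R (qf_eval Q v * qf_eval Q w) (bilin (gram Q) v w ^+ 2).
Proof.
move=> s; have [->|w0] := eqVneq w 0.
  by rewrite [qf_eval Q 0]qf_evalE /bilin trmx0 !mulmx0 mxE mulr0 expr0n.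
have q_gt0 := tot_pos_def_gt0 w0 s; rewrite rmorph0 in q_gt0.
pose u := qf_eval Q w *: v - bilin (gram Q) v w *: w.
have := proj1 Q_pos u s; rewrite /u [qf_eval Q (_ - _)]qf_evalE.
rewrite (bilin_quad_sub (gram_sym Q) (esym (qf_evalE Q w)) erefl) -qf_evalE.
by rewrite rmorph0 rmorphM pmulr_rge0 // rmorphB subr_ge0 mulrC.
Qed.

End Definite.

(** * Subtracting a multiple of a square *)

Section Decompose.
Variables (R : realType) (K : fieldExtType rat) (n : nat) (Q : 'M[K]_n).
Implicit Types (L x : 'rV[K]_n).

Definition qf_sub_sq (a : K) L := qf_of_gram (gram Q - a *: (L^T *m L)).

Lemma lf_evalE L x : lf_eval L x = (L *m x^T) 0 0.
Proof. by rewrite mxE; apply: eq_bigr => i _; rewrite mxE. Qed.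

Lemma qf_sub_sq_eval a L x :
  qf_eval Q x = qf_eval (qf_sub_sq a L) x + a * lf_eval L x ^+ 2.
Proof.
have G_sym : (gram Q - a *: (L^T *m L))^T = gram Q - a *: (L^T *m L).
  by rewrite linearB linearZ /= gram_sym trmx_mul trmxK.
rewrite !qf_evalE gramK // /bilin mulmxBr mulmxBl -scalemxAr -scalemxAl.
rewrite [in RHS]mxE [X in _ + X + _]mxE [X in _ - X + _]mxE.
suff -> : (x *m (L^T *m L) *m x^T) 0 0 = lf_eval L x ^+ 2 by rewrite subrK.
have -> : x *m (L^T *m L) *m x^T = (L *m x^T)^T *m (L *m x^T).
  by rewrite trmx_mul trmxK !mulmxA.
by rewrite mxE big_ord1 mxE -lf_evalE expr2.
Qed.

Lemma qf_sub_sq_OK a L : qf_over_OK Q -> in_OK a -> (forall i, in_OK (L 0 i)) ->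
  qf_over_OK (qf_sub_sq a L).
Proof.
move=> Q_OK a_OK L_OK; have [Gd G2] := gram_OK Q_OK.
have LL i j : in_OK ((a *: (L^T *m L)) i j).
  rewrite mxE mxE big_ord1 mxE; apply: in_OK_mul => //.
  exact: in_OK_mul.
have GLE i j : (gram Q - a *: (L^T *m L)) i j =
    gram Q i j - (a *: (L^T *m L)) i j.
  by rewrite [LHS]mxE [X in _ + X]mxE.
apply: qf_of_gram_OK => [i|i j]; rewrite GLE; first exact: in_OK_sub.
by rewrite mulrnBl; apply: in_OK_sub => //; apply: in_OK_mulrn.
Qed.

(** The vector w := L M^-1 represents L through the bilinear form of Q, so
    Cauchy-Schwarz bounds L(x)^2 by Q(x) Q(w), and a Q(w) is at most 1. *)
Lemma qf_sub_sq_psd a L : tot_pos_def R Q -> L != 0 ->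
  tot_ge R (qf_eval Q (L *m invmx (gram Q)))^-1 a ->
  tot_pos_semidef R (qf_sub_sq a L).
Proof.
move=> Q_pos L0 le_a x s.
pose w := L *m invmx (gram Q).
have GU := gram_unit Q_pos.
have wG : w *m gram Q = L by rewrite mulmxKV.
have w0 : w != 0 by apply: contra_neq L0 => w0; rewrite -wG w0 mul0mx.
have q_gt0 := tot_pos_def_gt0 Q_pos w0 s; rewrite rmorph0 in q_gt0.
have := cauchy_schwarz Q_pos x w s.
rewrite (bilinC _ _ (gram_sym Q)) /bilin wG -lf_evalE => CS.
have -> : qf_eval (qf_sub_sq a L) x = qf_eval Q x - a * lf_eval L x ^+ 2.
  by rewrite (qf_sub_sq_eval a L) addrK.
rewrite rmorph0 rmorphB subr_ge0 rmorphM.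
apply: le_trans (_ : (s (qf_eval Q w))^-1 * s (lf_eval L x ^+ 2) <= _).
  rewrite ler_wpM2r //; first by rewrite rmorphXn sqr_ge0.
  by have := le_a s; rewrite fmorphV.
by rewrite mulrC ler_pdivrMr // -rmorphM.
Qed.
End Decompose.

(** * The dual form *)

Section Dual.
Variables (R : realType) (K : fieldExtType rat) (n : nat) (Q : 'M[K]_n).

Definition dual_qf (m : nat) := qf_of_gram (m%:R *: invmx (gram Q)).

Lemma gram_dual m : gram (dual_qf m) = m%:R *: invmx (gram Q).
Proof. by rewrite gramK // linearZ /= trmx_inv gram_sym. Qed.

(** Up to the factor m, the dual form at x is the value of Q at the vector that
    represents the linear form x; positivity of Q thus passes to its dual. *)
Lemma dual_eval m x : gram Q \in unitmx ->
  qf_eval (dual_qf m) x = m%:R * qf_eval Q (x *m invmx (gram Q)).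
Proof.
move=> GU; rewrite !qf_evalE gram_dual /bilin -scalemxAr -scalemxAl mxE.
congr (_ * _); congr (fun_of_matrix _ _ _).
by rewrite mulmxKV // trmx_mul trmx_inv gram_sym mulmxA.
Qed.

Lemma dual_pos m : (0 < m)%N -> tot_pos_def R Q -> tot_pos_def R (dual_qf m).
Proof.
move=> m_gt0 Q_pos; have GU := gram_unit Q_pos.
split=> [v s|v]; rewrite dual_eval //.
  by rewrite rmorphM rmorph_nat rmorph0 mulr_ge0 // -(rmorph0 s) (proj1 Q_pos).
move/eqP; rewrite mulf_eq0 (negPf (natK_neq0 _ m_gt0)) /= => /eqP/(proj2 Q_pos).
by move/(congr1 (mulmx^~ (gram Q))); rewrite mulmxKV // mul0mx.
Qed.

Lemma dual_det m :
  qf_det (dual_qf m) = m%:R ^+ n / qf_det Q.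
Proof. by rewrite /qf_det gram_dual detZ det_inv. Qed.

Lemma dual_OK : exists m, (0 < m)%N /\ qf_over_OK (dual_qf m).
Proof.
have [m [m_gt0 mP]] := @uniform_multiple K (@in_OK K) ('I_n * 'I_n)%type
  (fun ij => invmx (gram Q) ij.1 ij.2) (@in_OK_mulrn K)
  (fun ij => integral_multiple _).
exists m; split=> //; apply: qf_of_gram_OK => [i|i j].
  by rewrite mxE mulr_natl; apply: (mP (i, i)).
by rewrite mxE mulr_natl; apply: in_OK_mulrn; apply: (mP (i, j)).
Qed.
End Dual.

(** * Minimal vectors and the Hermite constant *)

Lemma inf_attained (R : realType) (S : set R) (m : R) :
  S m -> (forall y, S y -> m <= y) -> inf S = m.
Proof.
move=> Sm m_min; apply/le_anti; rewrite ge_inf //=; last by exists m.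
by apply: lb_le_inf => //; exists m.
Qed.

Lemma natr_set_min (R : realType) (T : Type) (P : T -> Prop) (f : T -> R) :
  (exists x, P x) -> (forall x, P x -> exists k : nat, f x = k%:R) ->
  exists x, P x /\ forall y, P y -> f x <= f y.
Proof.
move=> [x0 Px0] fP.
pose S := fun k : nat => `[< exists x, P x /\ f x = k%:R >].
have exS : exists k, S k.
  by have [k fk] := fP _ Px0; exists k; apply/asboolP; exists x0.
case: (ex_minnP exS) => k /asboolP[x [Px fx]] k_min; exists x; split=> // y Py.
have [l fl] := fP _ Py; rewrite fx fl ler_nat; apply: k_min.
by apply/asboolP; exists y.
Qed.

Section Min.
Variables (R : realType) (K : fieldExtType rat) (n : nat) (a : 'M[K]_n).
Hypotheses (K_real : totally_real R K) (n_gt0 : (0 < n)%N).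
Hypotheses (a_OK : qf_over_OK a) (a_pos : tot_pos_def R a).

Lemma qf_eval_OK (x : 'rV[K]_n) :
  (forall i, in_OK (x 0 i)) -> in_OK (qf_eval a x).
Proof.
move=> x_OK.
apply: big_ind => [|y z|i _]; [exact: in_OK0 | exact: in_OK_add |].
apply: big_ind => [|y z|j _]; [exact: in_OK0 | exact: in_OK_add |].
by do 2?apply: in_OK_mul => //; apply: (proj1 a_OK).
Qed.

Lemma normKQ_nat (x : K) : in_OK x -> tot_pos R x ->
  exists k : nat, ratr (normKQ x) = k%:R :> R.
Proof.
move=> /normKQ_int x_int x_pos; have := normKQ_gt0 K_real x_pos.
case/intrP: x_int => -[k|k] ->; last by rewrite ltr0z.
by move=> _; exists k; rewrite ratr_int.
Qed.

(** Norms of values at nonzero integral vectors are natural numbers, which are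
    well ordered. *)
Lemma qf_min_attained : exists x : 'rV[K]_n,
  [/\ forall i, in_OK (x 0 i), x != 0 & qf_min R a = ratr (normKQ (qf_eval a x))].
Proof.
have [||x [[x_OK x0] x_min]] := @natr_set_min R 'rV[K]_n
    (fun x => (forall i, in_OK (x 0 i)) /\ x != 0)
    (fun x => ratr (normKQ (qf_eval a x))).
- exists (const_mx 1); split=> [i|]; first by rewrite mxE; exact: in_OK1.
  apply/eqP => /rowP/(_ (Ordinal n_gt0)); rewrite !mxE => /eqP.
  by rewrite oner_eq0.
- move=> x [x_OK x0]; apply: normKQ_nat; first exact: qf_eval_OK.
  exact: tot_pos_def_gt0.
- exists x; split=> //; apply: inf_attained; first by exists x.
  by move=> _ [y [y_OK y0 ->]]; apply: x_min.
Qed.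

Lemma ratr_normKQ_gt0 (x : K) : tot_pos R x -> 0 < ratr (normKQ x) :> R.
Proof. by move=> x_pos; rewrite ltr0q; apply: normKQ_gt0 x_pos. Qed.

End Min.

Section Main.
Variables (R : realType) (K : fieldExtType rat) (n : nat).
Hypotheses (K_real : totally_real R K) (n_gt0 : (0 < n)%N).

Lemma hermite_ge (a : 'M[K]_n) : qf_over_OK a -> tot_pos_def R a ->
  ((qf_min R a / ratr (normKQ (qf_det a)) `^ n%:R^-1)%:E <= hermite R K n)%E.
Proof. by move=> a_OK a_pos; apply: ereal_sup_ubound; exists a. Qed.

Lemma normKQ_det_neq0 (a : 'M[K]_n) : tot_pos_def R a ->
  normKQ (qf_det a) != 0.
Proof.
by move/gram_unit; rewrite unitmxE unitfE; apply: normKQ_neq0.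
Qed.

(** One definite form over O_K gives a positive quotient. *)
Lemma hermite_gt0 (a : 'M[K]_n) : qf_over_OK a -> tot_pos_def R a ->
  (0 < hermite R K n)%E.
Proof.
move=> a_OK a_pos; apply: lt_le_trans (hermite_ge a_OK a_pos).
have [x [_ x0 ->]] := qf_min_attained K_real n_gt0 a_OK a_pos.
rewrite lte_fin divr_gt0 //; first exact/(ratr_normKQ_gt0 K_real)/tot_pos_def_gt0.
rewrite lt_def powR_ge0 andbT powR_eq0 fmorph_eq0.
by rewrite (negPf (normKQ_det_neq0 a_pos)).
Qed.

(** Since n > 0 and c > 0, an infinite constant would make the left-hand side
    infinite. *)
Lemma hermite_fin (a : 'M[K]_n) (c d : R) :
  qf_over_OK a -> tot_pos_def R a -> 0 < c ->
  (hermite R K n ^+ n * c%:E <= d%:E)%E -> exists2 g, 0 < g & hermite R K n = g%:E.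
Proof.
move=> a_OK a_pos c_gt0; have := hermite_gt0 a_OK a_pos.
case: (hermite R K n) => [g||] //; first by rewrite lte_fin; exists g.
move=> _; suff -> : (+oo ^+ n = +oo :> \bar R)%E by rewrite gt0_mulye.
case: n n_gt0 => // k _; elim: k => [|k IH]; first by [].
by rewrite expeS IH mulyy.
Qed.


Lemma powR_invn_exprn (x : R) : 0 <= x -> (x ^+ n) `^ n%:R^-1 = x.
Proof.
move=> x_ge0; rewrite -powR_mulrn // -powRrM mulfV ?powRr1 //.
by rewrite pnatr_eq0 -lt0n.
Qed.

(** L is a minimal vector of the dual form m M^-1, whose determinant is
    m^n / det Q; the factor N(m) cancels from the Hermite inequality. *)
Lemma dual_short_vector (Q : 'M[K]_n) (g C : R) :
  tot_pos_def R Q -> 0 < C -> 0 < g -> hermite R K n = g%:E ->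
  (g * C) ^+ n <= ratr (normKQ (qf_det Q)) ->
  exists L : 'rV[K]_n, [/\ forall i, in_OK (L 0 i), L != 0 &
    C <= ratr (normKQ (qf_eval Q (L *m invmx (gram Q)))^-1)].
Proof.
move=> Q_pos C_gt0 g_gt0 gE det_ge.
have [m [m_gt0 A_OK]] := dual_OK Q.
have A_pos := dual_pos m_gt0 Q_pos.
have [L [L_OK L0 minE]] := qf_min_attained K_real n_gt0 A_OK A_pos.
have w0 : L *m invmx (gram Q) != 0.
  apply: contra_neq L0 => w0.
  by rewrite -(mulmxKV (gram_unit Q_pos) L) w0 mul0mx.
have q_pos := tot_pos_def_gt0 Q_pos w0.
exists L; split=> //; move: (hermite_ge A_OK A_pos).
rewrite gE lee_fin minE dual_eval ?(gram_unit Q_pos) // dual_det.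
set q := qf_eval Q _ in q_pos *.
have m_pos : tot_pos R (m%:R : K) by move=> s; rewrite rmorph0 rmorph_nat ltr0n.
have D_gt0 := ratr_normKQ_gt0 K_real m_pos.
have q_gt0 := ratr_normKQ_gt0 K_real q_pos.
have q0 : q != 0 := tot_pos_def_neq0 Q_pos w0.
have d0 : qf_det Q != 0 by rewrite -unitfE -unitmxE (gram_unit Q_pos).
rewrite normKQV // !normKQM normKQX normKQV // !(fmorphV, rmorphM, rmorphXn) /=.
set D := ratr (normKQ m%:R) in D_gt0 *; set Nq := ratr (normKQ q) in q_gt0 *.
set d := ratr (normKQ (qf_det Q)) in det_ge * => short.
have d_ge0 : 0 <= d.
  by apply: le_trans det_ge; rewrite exprn_ge0 // mulr_ge0 ?ltW.
(* r is N(det Q)^(1/n). *)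
pose r := d `^ n%:R^-1.
have rn : r ^+ n = d.
  by rewrite -powR_mulrn ?powR_ge0 // -powRrM mulVf ?powRr1 // pnatr_eq0 -lt0n.
have r_ge : g * C <= r.
  by rewrite -(ler_pXn2r n_gt0) ?nnegrE ?powR_ge0 ?rn // mulr_ge0 ?ltW.
have r_gt0 : 0 < r by apply: lt_le_trans r_ge; rewrite mulr_gt0.
move: short; rewrite -rn -expr_div_n powR_invn_exprn; last first.
  by rewrite divr_ge0 ?(ltW D_gt0) ?(ltW r_gt0).
have -> : D * Nq / (D / r) = Nq * r.
  by field; rewrite !gt_eqF.
move=> short; rewrite -[C]invrK lef_pV2 ?posrE ?invr_gt0 //.
rewrite -[_^-1]mul1r ler_pdivlMr // -(ler_pM2l g_gt0) mulr1.
by apply: le_trans _ short; rewrite mulrCA ler_wpM2l ?(ltW q_gt0).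
Qed.

End Main.

Theorem theorem1p1 (R : realType) (K : fieldExtType rat)
    (K_real : totally_real R K) (n : nat) (n_gt0 : (0 < n)%N)
    (Q : 'M[K]_n) (Q_OK : qf_over_OK Q) (Q_pos : tot_pos_def R Q)
    (C : R) (C_gt0 : 0 < C)
    (C_prop : forall b : K, tot_pos R b -> C <= ratr (normKQ b) ->
       exists a : K, [/\ in_OK a, tot_pos R a & tot_ge R b a])
    (Q_det : (hermite R K n ^+ n * (C ^+ n)%:E
                <= (ratr (normKQ (qf_det Q)))%:E)%E) :
  exists (H : 'M[K]_n) (a : K) (L : 'rV[K]_n),
    [/\ qf_over_OK H, tot_pos_semidef R H,
        in_OK a /\ tot_pos R a,
        (forall i, in_OK (L 0 i)) /\ L != 0
      & forall x : 'rV[K]_n,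
          qf_eval Q x = qf_eval H x + a * lf_eval L x ^+ 2].
Proof.
have [g g_gt0 gE] := hermite_fin K_real n_gt0 Q_OK Q_pos (exprn_gt0 n C_gt0) Q_det.
move: Q_det; rewrite gE -EFin_expe -EFinM lee_fin -exprMn => det_ge.
have [L [L_OK L0 q_ge]] := dual_short_vector K_real n_gt0 Q_pos C_gt0 g_gt0 gE det_ge.
have [|a [a_OK a_pos a_le]] := C_prop _ _ q_ge.
  move=> s; rewrite rmorph0 fmorphV invr_gt0 -(rmorph0 s).
  apply: tot_pos_def_gt0 => //; apply: contra_neq L0 => w0.
  by rewrite -(mulmxKV (gram_unit Q_pos) L) w0 mul0mx.
exists (qf_sub_sq Q a L), a, L; split=> // [||x].
- exact: qf_sub_sq_OK.
- exact: qf_sub_sq_psd.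
- exact: qf_sub_sq_eval.
Qed.
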